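(* For a ring $R\neq 0$, the following are equivalent: (1) $R$ is a domain; (2) every nonzero completely prime right ideal of $R$ contains a left regular element; (3) every nonzero completely prime right ideal of $R$ has a nonempty finite subset whose left annihilator (in $R$) is zero.
   Context: Rings are associative with $1$, not necessarily commutative. A right ideal $P\subsetneq R$ is completely prime if for all $a,b\in R$ with $aP\subseteq P$, $ab\in P$ implies $a\in P$ or $b\in P$. An element $s\in R$ is left regular if its left annihilator $\{r\in R: rs=0\}$ is $0$. The left annihilator of a subset $X\subseteq R$ is $\{r\in R: rx=0\text{ for all }x\in X\}$. A (not necessarily commutative) nonzero ring is a domain if it has no nonzero elements $a,b$ with $ab=0$. *)

(* Defs.v *)
From HB Require Import structures.
From mathcomp Require Import all_boot all_algebra.
From mathcomp Require Import boolp classical_sets cardinality.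

Set Implicit Arguments.
Unset Strict Implicit.
Unset Printing Implicit Defensive.

Import GRing.Theory.
Local Open Scope classical_set_scope.
Local Open Scope ring_scope.

(* [nzRingType] is the type of associative, not necessarily commutative rings
   with 1 <> 0; the requirement that a domain be nonzero is thus built in. *)
Definition is_domain (R : nzRingType) : Prop :=
  ~ exists a b : R, [/\ a <> 0, b <> 0 & a * b = 0].

Definition right_ideal (R : nzRingType) (P : set R) : Prop :=
  [/\ P 0,
      forall x y, P x -> P y -> P (x - y)
    & forall x r, P x -> P (x * r)].

Definition completely_prime (R : nzRingType) (P : set R) : Prop :=
  [/\ right_ideal P,
      P <> [set: R]
    & forall a b : R, [set a * p | p in P] `<=` P ->
        P (a * b) -> P a \/ P b].

Definition left_annihilator (R : nzRingType) (X : set R) : set R :=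
  [set r | forall x, X x -> r * x = 0].

(* With this convention a left regular element is one whose right
   multiplication map is injective; [GRing.lreg] is the opposite notion. *)
Definition left_regular (R : nzRingType) (s : R) : Prop :=
  [set r : R | r * s = 0] = [set 0].

(* Main.v *)
Require Import Defs.
From HB Require Import structures.
From mathcomp Require Import all_boot all_algebra.
From mathcomp Require Import boolp classical_sets cardinality.

(** In a domain every nonzero element is left regular, and a left regular
    element gives a singleton with zero left annihilator, so everything rests on
    recovering the domain property from the third condition.

    Call a right ideal cofaithful if it contains a nonempty finite subset with
    zero left annihilator.  If [a * b = 0] with [a] and [b] nonzero, then [a]
    annihilates the nonzero right ideal [b R], which is therefore not
    cofaithful.  A finite subset of the union of a chain already lies in one
    member of the chain, so Zorn's lemma enlarges [b R] to a right ideal that is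
    maximal among those that are not cofaithful ([ex_maximal_not_cofaithful]).

    Such a maximal right ideal is completely prime, by the one-sided version of
    the classical principle that ideals maximal with respect to a suitable
    property are prime.  It applies because cofaithful right ideals form an Oka
    family: if [I + a R] and [a^-1 I = {r | a r \in I}] are cofaithful, then so
    is [I] ([cofaithful_oka]).  If [P] is maximal as above and [c], [d] lie
    outside [P] while [c P] is contained in [P] and [c * d] lies in [P], then
    [P + c R] contains [P] and [c], and [c^-1 P] contains [P] and [d]; both are
    strictly larger than [P], hence cofaithful, so [P] would be cofaithful.  The
    result is a nonzero completely prime right ideal violating the third
    condition. *)

Set Implicit Arguments.
Unset Strict Implicit.
Unset Printing Implicit Defensive.

Import GRing.Theory.
Local Open Scope classical_set_scope.
Local Open Scope ring_scope.

Definition cofaithful (R : nzRingType) (P : set R) : Prop :=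
  exists X : set R,
    [/\ X !=set0, finite_set X, X `<=` P & left_annihilator X = [set 0]].

Definition adjoin (R : nzRingType) (I : set R) (a : R) : set R :=
  [set i + a * r | i in I & r in [set: R]].

Definition colon (R : nzRingType) (I : set R) (a : R) : set R :=
  [set r | I (a * r)].

Lemma left_annihilator_eq0 (R : nzRingType) (X : set R) :
  left_annihilator X = [set 0] <->
  forall r, (forall x, X x -> r * x = 0) -> r = 0.
Proof.
split=> [X0 r rX|X0]; first by have : left_annihilator X r by []; rewrite X0.
by apply/seteqP; split=> [r /X0//|_ -> x _]; rewrite mul0r.
Qed.

Lemma left_annihilator1 (R : nzRingType) (s : R) :
  left_annihilator [set s] = [set r | r * s = 0].
Proof. by apply/seteqP; split=> r /= rs; [exact: rs|move=> _ ->]. Qed.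

Lemma left_regular_cofaithful (R : nzRingType) (P : set R) (s : R) :
  P s -> left_regular s -> cofaithful P.
Proof.
move=> Ps s_reg; exists [set s]; split; first by exists s.
- exact: finite_set1.
- by move=> _ ->.
- by rewrite left_annihilator1.
Qed.

Lemma cofaithfulT (R : nzRingType) : cofaithful [set: R].
Proof.
apply: (@left_regular_cofaithful _ _ 1) => //.
by apply/seteqP; split=> r /=; rewrite mulr1.
Qed.

Lemma domain_left_regular (R : nzRingType) (s : R) :
  is_domain R -> s <> 0 -> left_regular s.
Proof.
move=> domR s0; apply/seteqP; split=> [r /= rs0|_ ->]; last exact: mul0r.
by apply: contrapT => r0; apply: domR; exists r, s.
Qed.

Lemma right_ideal_neq0 (R : nzRingType) (P : set R) :
  right_ideal P -> P <> [set 0] -> exists2 s, P s & s <> 0.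
Proof.
move=> [P0 _ _] PN0; apply: contrapT => noP; apply: PN0.
apply/seteqP; split=> [s Ps|_ ->//].
by apply: contrapT => s0; apply: noP; exists s.
Qed.

Lemma right_ideal_principal (R : nzRingType) (b : R) :
  right_ideal (range ( *%R b)).
Proof.
split; first by exists 0; rewrite ?mulr0.
- by move=> _ _ [r _ <-] [s _ <-]; exists (r - s); rewrite ?mulrBr.
- by move=> _ s [r _ <-]; exists (r * s); rewrite ?mulrA.
Qed.

Lemma right_ideal_adjoin (R : nzRingType) (I : set R) (a : R) :
  right_ideal I -> right_ideal (adjoin I a).
Proof.
move=> [I0 IB IM]; split.
- by exists 0 => //; exists 0; rewrite // mulr0 addr0.
- move=> _ _ [i Ii [r _ <-]] [j Ij [s _ <-]].
  exists (i - j); first exact: IB.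
  by exists (r - s); rewrite // mulrBr opprD addrACA.
- move=> _ s [i Ii [r _ <-]]; exists (i * s); first exact: IM.
  by exists (r * s); rewrite // mulrDl mulrA.
Qed.

Lemma right_ideal_colon (R : nzRingType) (I : set R) (a : R) :
  right_ideal I -> right_ideal (colon I a).
Proof.
move=> [I0 IB IM]; split; rewrite /colon /=.
- by rewrite mulr0.
- by move=> x y Ix Iy; rewrite mulrBr; exact: IB.
- by move=> x r Ix; rewrite mulrA; exact: IM.
Qed.

(** Let the finite sets [X] and [Y] witness the two hypotheses, and write each
    [x] in [X] as [x = i + a * r] with [i] in [I].  Anything that kills [a Y] and
    all the [i] first kills [a], because [Y] has zero left annihilator; it then
    kills all of [X], so it is zero. *)
Lemma cofaithful_oka (R : nzRingType) (I : set R) (a : R) :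
  cofaithful (adjoin I a) -> cofaithful (colon I a) -> cofaithful I.
Proof.
move=> [X [_ fX XI /left_annihilator_eq0 annX]].
move=> [Y [[y Yy] fY YI /left_annihilator_eq0 annY]].
have /choice[f fP] x : exists i, X x -> I i /\ exists r, i + a * r = x.
  have [/XI[i Ii [r _ <-]]|nXx] := pselect (X x); last by exists 0.
  by exists i => _; split=> //; exists r.
exists (f @` X `|` *%R a @` Y); split.
- by exists (a * y); right; exists y.
- by rewrite finite_setU; split; exact: finite_image.
- by move=> _ [[x /fP[? _] <-]|[z /YI ? <-]].
apply/left_annihilator_eq0 => r r0.
have ra0 : r * a = 0.
  by apply: annY => z Yz; rewrite -mulrA; apply: r0; right; exists z.
apply: annX => x Xx; have [_ [s <-]] := fP x Xx.
by rewrite mulrDr mulrA ra0 mul0r addr0; apply: r0; left; exists x.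
Qed.

Lemma finite_subset_chain (T : Type) (F : set (set T)) (X : set T) :
  total_on F subset -> F !=set0 -> finite_set X ->
  X `<=` \bigcup_(A in F) A -> exists2 A, F A & X `<=` A.
Proof.
elim/Pchoice: T => T in F X *.
move=> Ftot [A0 FA0] /finite_seqP[s ->].
elim: s => [_|x s IHs sF]; first by exists A0.
have [|A FA sA] := IHs; first by move=> y ys; apply: sF; rewrite /= inE ys orbT.
have [|B FB Bx] := sF x; first by rewrite /= inE eqxx.
have [AB|BA] := Ftot _ _ FA FB.
- by exists B => // y; rewrite /= inE => /predU1P[->//|/sA/AB].
- by exists A => // y; rewrite /= inE => /predU1P[->|/sA//]; exact: BA.
Qed.

Lemma right_ideal_bigcup_chain (R : nzRingType) (F : set (set R)) :
  F !=set0 -> total_on F subset -> (forall A, F A -> right_ideal A) ->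
  right_ideal (\bigcup_(A in F) A).
Proof.
move=> [A FA] Ftot Fid; split.
- by exists A => //; case: (Fid _ FA).
- move=> x y [B FB Bx] [C FC Cy].
  have [BC|CB] := Ftot _ _ FB FC.
  + by exists C => //; have [_ CB _] := Fid _ FC; apply: CB => //; exact: BC.
  + by exists B => //; have [_ BB _] := Fid _ FB; apply: BB => //; exact: CB.
- by move=> x r [B FB Bx]; exists B => //; have [_ _ BM] := Fid _ FB; exact: BM.
Qed.

(** Zorn's lemma applies because being cofaithful is witnessed by finitely many
    elements, so a union of a chain is cofaithful only if some member of the
    chain is. *)
Lemma ex_maximal_not_cofaithful (R : nzRingType) (J : set R) :
  right_ideal J -> ~ cofaithful J ->
  exists P, [/\ right_ideal P, ~ cofaithful P, J `<=` P &
    forall Q, right_ideal Q -> P `<` Q -> cofaithful Q].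
Proof.
move=> Jid Jncof.
pose good (A : set R) := right_ideal A /\ ~ cofaithful A.
(* Zorn_bigcup also asks for the union of the empty chain, which is empty and so
   not a right ideal; testing J `|` A in place of A makes the empty set
   admissible. *)
have [C Cgood Ctot|A [Agood Amax]] := @Zorn_bigcup R [set A | good (J `|` A)].
  have [C0|/set0P CN0] := eqVneq C set0.
    by rewrite C0 /= bigcup_set0 setU0.
  pose F := setU J @` C.
  have FN0 : F !=set0 by case: CN0 => A CA; exists (J `|` A), A.
  have Ftot : total_on F subset.
    move=> _ _ [A CA <-] [B CB <-].
    by have [AB|BA] := Ctot _ _ CA CB; [left|right]; exact: setUS.
  have Fgood A : F A -> good A by move=> [B CB <-]; exact: Cgood.
  rewrite /=; have -> : (J `|` \bigcup_(A in C) A) = \bigcup_(A in F) A.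
    apply/seteqP; split=> x.
    - case: CN0 => A CA [Jx|[B CB Bx]].
      + by exists (J `|` A); [exists A|left].
      + by exists (J `|` B); [exists B|right].
    - by move=> [_ [A CA <-] [Jx|Ax]]; [left|right; exists A].
  split; first by apply: right_ideal_bigcup_chain => // A /Fgood[].
  move=> [X [X0 fX XF annX]].
  have [A FA XA] := finite_subset_chain Ftot FN0 fX XF.
  by have [_] := Fgood _ FA; apply; exists X.
exists (J `|` A); case: (Agood) => Aid Ancof; split=> // Q Qid [AQ QA].
apply: contrapT => Qncof; apply: (Amax Q).
  by split=> [x Ax|]; [apply: AQ; right|move=> QA'; apply: QA => x /QA'; right].
by rewrite /= setUidr// => x Jx; apply: AQ; left.
Qed.

(** The condition [a P] contained in [P] in the definition of a completely prime
    right ideal is what makes [colon P a] contain [P], so that maximality can be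
    used on it. *)
Lemma maximal_not_cofaithful_completely_prime (R : nzRingType) (P : set R) :
  right_ideal P -> ~ cofaithful P ->
  (forall Q, right_ideal Q -> P `<` Q -> cofaithful Q) ->
  completely_prime P.
Proof.
move=> Pid Pncof Pmax; split=> //.
  by move=> PT; apply: Pncof; rewrite PT; exact: cofaithfulT.
have [P0 _ _] := Pid.
move=> a b aP Pab; apply: contrapT => /not_orP[nPa nPb].
apply: Pncof; apply: (@cofaithful_oka _ _ a); apply: Pmax.
- exact: right_ideal_adjoin.
- split=> [x Px|PaP]; first by exists x => //; exists 0; rewrite // mulr0 addr0.
  by apply: nPa; apply: PaP; exists 0 => //; exists 1; rewrite // mulr1 add0r.
- exact: right_ideal_colon.
- split=> [x Px|PaP]; first by apply: aP; exists x.
  by apply: nPb; exact: PaP.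
Qed.

Lemma zero_divisor_not_cofaithful (R : nzRingType) (a b : R) :
  a <> 0 -> a * b = 0 -> ~ cofaithful (range ( *%R b)).
Proof.
move=> a0 ab0 [X [_ _ Xb /left_annihilator_eq0 annX]].
by apply: a0; apply: annX => _ /Xb[r _ <-]; rewrite mulrA ab0 mul0r.
Qed.

Lemma completely_prime_cofaithful_domain (R : nzRingType) :
  (forall P : set R, completely_prime P -> P <> [set 0] -> cofaithful P) ->
  is_domain R.
Proof.
move=> cofR [a [b [a0 b0 ab0]]].
have [P [Pid Pncof bP Pmax]] := ex_maximal_not_cofaithful
  (right_ideal_principal b) (zero_divisor_not_cofaithful a0 ab0).
apply: (Pncof); apply: cofR.
  exact: maximal_not_cofaithful_completely_prime.
move=> P0; apply: b0; have : P b by apply: bP; exists 1; rewrite ?mulr1.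
by rewrite P0.
Qed.

Theorem corollary5p8 (R : nzRingType) :
  (is_domain R <->
     (forall P : set R, completely_prime P -> P <> [set 0] ->
        exists s : R, P s /\ left_regular s)) /\
  (is_domain R <->
     (forall P : set R, completely_prime P -> P <> [set 0] ->
        exists X : set R,
          [/\ X !=set0, finite_set X, X `<=` P & left_annihilator X = [set 0]])).
Proof.
have dom_reg : is_domain R -> forall P : set R, completely_prime P ->
    P <> [set 0] -> exists s : R, P s /\ left_regular s.
  move=> domR P [Pid _ _] PN0; have [s Ps s0] := right_ideal_neq0 Pid PN0.
  by exists s; split=> //; exact: domain_left_regular.
have reg_cof (P : set R) : (exists s : R, P s /\ left_regular s) -> cofaithful P.
  by move=> [s [Ps s_reg]]; exact: left_regular_cofaithful s_reg.
split; split=> //.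
- move=> reg; apply: completely_prime_cofaithful_domain => P cP PN0.
  exact/reg_cof/reg.
- by move=> domR P cP PN0; exact/reg_cof/dom_reg.
- exact: completely_prime_cofaithful_domain.
Qed.
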